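(* For every integer $n\ge 1$ the following identities hold: (i) $\tau(n) = n^2\sigma_7(n) - 540 \sum_{m=1}^{n-1}m(n-m)\sigma_3(m)\sigma_3(n-m)$; (ii) $\tau(n) = -\frac{5}{4} n^2\sigma_7(n) + \frac{9}{4} n^2\sigma_3(n) + 540\sum_{m=1}^{n-1}m^2\sigma_3(m)\sigma_3(n-m)$; (iii) $\tau(n) = n^2\sigma_7(n) - \frac{1080}{n}\sum_{m=1}^{n-1}m^2(n-m)\sigma_3(m)\sigma_3(n-m)$; (iv) $\tau(n) = -\frac{1}{2} n^2\sigma_7(n) + \frac{3}{2} n^2\sigma_3(n) + \frac{360}{n}\sum_{m=1}^{n-1}m^3\sigma_3(m)\sigma_3(n-m)$.
   Context: $\tau(n)$ is Ramanujan's tau function, defined by $q\prod_{n\ge 1}(1-q^n)^{24} = \sum_{n\ge 1}\tau(n)q^n$. For $k\ge 1$, $\sigma_k(n)=\sum_{d\mid n} d^k$ (sum over positive divisors of $n$). For $n=1$ the sum $\sum_{m=1}^{n-1}$ is empty and equals $0$. *)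

(* Defs.v *)
From mathcomp Require Import all_boot all_order all_algebra.

Set Implicit Arguments.
Unset Strict Implicit.
Unset Printing Implicit Defensive.

Import Order.TTheory GRing.Theory Num.Theory.
Local Open Scope ring_scope.

Definition sigma (k n : nat) : nat := (\sum_(d <- divisors n) d ^ k)%N.

Definition delta_partial (N : nat) : {poly int} :=
  'X * \prod_(1 <= k < N.+1) (1 - 'X^k) ^+ 24.

(* The coefficient of q^n in the formal power series q prod_{k>=1} (1-q^k)^24.
   The factors with k > n do not affect this coefficient, so it is read off
   the n-th partial product; see delta_partial_coef. *)
Definition tau (n : nat) : int := (delta_partial n)`_n.

Lemma delta_partial_coef (n N : nat) :
  (n <= N)%N -> (delta_partial N)`_n = tau n.
Proof.
elim: N => [|N IHN]; first by rewrite leqn0 => /eqP->.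
rewrite leq_eqVlt => /predU1P[-> // | lt_nN]; rewrite -IHN //.
rewrite /delta_partial big_nat_recr //= mulrA.
set P := 'X * _.
have [r ->]: exists r : {poly int}, (1 - 'X^(N.+1)) ^+ 24 = 1 + r * 'X^(N.+1).
  elim: 24%N => [|e [r IHr]]; first by exists 0; rewrite expr0 mul0r addr0.
  exists (r * (1 - 'X^(N.+1)) - 1).
  rewrite exprSr IHr mulrDl mul1r mulrBl mulrAC mul1r -addrA.
  by rewrite [- _ + _]addrC.
by rewrite mulrDr mulr1 coefD mulrA coefMXn lt_nN addr0.
Qed.

(* Main.v *)
(* Counting representations n = a x + b y by positive integers, the shear
   (a, b, x, y) -> (a, a + b, x - y, y) from {x > y} onto {b > a} gives, for
   every H that is even, symmetric and satisfies H(a, b) = H(a, - a - b),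
     sum (H(a, b) - H(a, - b)) = sum_{x = y} H(a, b) - sum_{a = b} H(a, 0)
   (Skoruppa).  The powers of a^2 + a b + b^2 and (a b (a + b))^2 turn this into
   the convolutions of sigma_1 with sigma_1, sigma_3, sigma_5 and of sigma_3 with
   itself, that is, into Ramanujan's differential equations for the Eisenstein
   series P, Q, R and Q^2 = E_8.  Hence D(Q^3 - R^2) = P (Q^3 - R^2) with
   D = q d/dq; the product defining tau satisfies the same equation, so
   Q^3 - R^2 = 1728 sum tau(n) q^n.  Finally 36 (4 Q D^2 Q - 5 (D Q)^2) equals
   20 (Q^3 - R^2), whose coefficients give (i); the other identities follow from
   (i) and Q^2 = E_8 by the symmetry m <-> n - m. *)
Require Import Defs.
From mathcomp Require Import all_boot all_order all_algebra.
From mathcomp Require Import zify ring lra.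

Set Implicit Arguments.
Unset Strict Implicit.
Unset Printing Implicit Defensive.

Import Order.TTheory GRing.Theory Num.Theory.
Local Open Scope ring_scope.

(** * Representations n = a x + b y by positive integers *)

(** [f] and [g] need to be mutually inverse only on the two lists, which suits maps built from
    truncated subtraction. *)
Lemma sum_bij (T U : eqType) (V : zmodType) (s : seq T) (r : seq U)
    (f : T -> U) (g : U -> T) (G : U -> V) :
  uniq s -> uniq r ->
  {in s, forall t, f t \in r /\ g (f t) = t} ->
  {in r, forall u, g u \in s /\ f (g u) = u} ->
  \sum_(t <- s) G (f t) = \sum_(u <- r) G u.
Proof.
move=> us ur fs gr; rewrite -(big_map f predT).
apply: perm_big; apply: uniq_perm => //.
  rewrite map_inj_in_uniq // => t t' /fs[_ fK] /fs[_ fK'] e.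
  by rewrite -fK -fK' e.
move=> u; apply/mapP/idP => [[t /fs[? _] ->] // | ru].
by have [? fK] := gr _ ru; exists (g u).
Qed.

Definition divisor_pairs (m : nat) : seq (nat * nat) :=
  [seq (d, m %/ d)%N | d <- divisors m].

Lemma mem_divisor_pairs m p : (0 < m)%N ->
  (p \in divisor_pairs m) = [&& 0 < p.1, 0 < p.2 & p.1 * p.2 == m]%N.
Proof.
case: p => a x /= m0; apply/mapP/idP => [[d]|/and3P[a0 x0 /eqP <-]].
  rewrite -dvdn_divisors // => dm [-> ->].
  have d0 := dvdn_gt0 m0 dm; rewrite mulnC divnK // eqxx andbT d0 /=.
  by rewrite divn_gt0 // dvdn_leq.
exists a; last by rewrite mulKn.
by rewrite -dvdn_divisors ?dvdn_mulr // muln_gt0 a0.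
Qed.

Lemma divisor_pairs_uniq m : uniq (divisor_pairs m).
Proof. by rewrite map_inj_uniq ?divisors_uniq // => d e []. Qed.

(* The pair of pairs ((a, x), (b, y)) stands for the representation
   n = a x + b y. *)
Definition reps (n : nat) : seq ((nat * nat) * (nat * nat)) :=
  [seq t | m <- index_iota 1 n,
           t <- [seq (p, q) | p <- divisor_pairs m, q <- divisor_pairs (n - m)]].

Lemma mem_reps n a x b y : (((a, x), (b, y)) \in reps n) =
  [&& 0 < a, 0 < x, 0 < b, 0 < y & a * x + b * y == n]%N.
Proof.
apply/allpairsPdep/idP => [[m [t [+ /allpairsP[[p q] [/= + + ->]] e]]]|].
  rewrite mem_index_iota => /andP[m0 mn].
  by rewrite !mem_divisor_pairs ?subn_gt0 //; case: e => <- <- /=; lia.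
move=> /and5P[a0 x0 b0 y0 /eqP e].
exists (a * x)%N, ((a, x), (b, y)); split => //; first by rewrite mem_index_iota; nia.
apply/allpairsP; exists ((a, x), (b, y)); rewrite -e addKn !mem_divisor_pairs; try nia.
by rewrite /= a0 x0 b0 y0 !eqxx.
Qed.

Lemma reps_uniq n : uniq (reps n).
Proof.
apply: allpairs_uniq_dep => [|m _|]; first exact: iota_uniq.
  by apply: allpairs_uniq; rewrite ?divisor_pairs_uniq // => -[? ?] [? ?] _ _ [-> ->].
(* The outer index is recovered from the entry as m = a x, so different m give different entries. *)
move=> _ _ /allpairsPdep[m [t [+ tm ->]]] /allpairsPdep[m' [t' [+ tm' ->]]] /= tt'.
rewrite !mem_index_iota => /andP[m0 _] /andP[m0' _]; move: tm tm'; rewrite {}tt'.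
move=> /allpairsP[[p q] /= [pm _ ->]] /allpairsP[[p' q'] /= [pm' _ [e _]]].
move: pm pm'; rewrite -{}e.
by rewrite !mem_divisor_pairs //= => /and3P[_ _ /eqP <-] /and3P[_ _ /eqP <-].
Qed.

(** * Sums of powers of the invariant forms along a + b = c *)

(** Keeping [c] apart from the bound [m] lets the induction on [m] run with [c] fixed; the later use
    is at c = m. The factor 6, like 30 and 420 below, clears the denominators of the power-sum
    polynomials. *)
Lemma sum_quad_form (R : comNzRingType) (c : R) (m : nat) : (0 < m)%N ->
  6 * (\sum_(1 <= a < m) (a%:R ^+ 2 + a%:R * (c - a%:R) + (c - a%:R) ^+ 2)) =
  (m%:R - 1) * (6 * c ^+ 2 - 3 * c * m%:R + m%:R * (2 * m%:R - 1)).
Proof.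
case: m => // m _; elim: m => [|m IHm].
  by rewrite big_geq // subrr !(mulr0, mul0r).
rewrite big_nat_recr //= mulrDr IHm -[m.+2]addn1 natrD.
by move: m.+1%:R => x; ring.
Qed.

Lemma sum_quad_form2 (R : comNzRingType) (c : R) (m : nat) : (0 < m)%N ->
  30 * (\sum_(1 <= a < m) (a%:R ^+ 2 + a%:R * (c - a%:R) + (c - a%:R) ^+ 2) ^+ 2) =
  (m%:R - 1) * (30 * c ^+ 4 - 30 * c ^+ 3 * m%:R
    + 15 * c ^+ 2 * m%:R * (2 * m%:R - 1) - 15 * c * m%:R ^+ 2 * (m%:R - 1)
    + m%:R * (2 * m%:R - 1) * (3 * m%:R ^+ 2 - 3 * m%:R - 1)).
Proof.
case: m => // m _; elim: m => [|m IHm].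
  by rewrite big_geq // subrr !(mulr0, mul0r).
rewrite big_nat_recr //= mulrDr IHm -[m.+2]addn1 natrD.
by move: m.+1%:R => x; ring.
Qed.

Lemma sum_quad_form3 (R : comNzRingType) (c : R) (m : nat) : (0 < m)%N ->
  420 * (\sum_(1 <= a < m) (a%:R ^+ 2 + a%:R * (c - a%:R) + (c - a%:R) ^+ 2) ^+ 3) =
  (m%:R - 1) * (420 * c ^+ 6 - 630 * c ^+ 5 * m%:R
    + 420 * c ^+ 4 * m%:R * (2 * m%:R - 1)
    - 735 * c ^+ 3 * m%:R ^+ 2 * (m%:R - 1)
    + 84 * c ^+ 2 * m%:R * (2 * m%:R - 1) * (3 * m%:R ^+ 2 - 3 * m%:R - 1)
    - 105 * c * m%:R ^+ 2 * (m%:R - 1) * (2 * m%:R ^+ 2 - 2 * m%:R - 1)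
    + 10 * m%:R * (2 * m%:R - 1) * (3 * m%:R ^+ 4 - 6 * m%:R ^+ 3 + 3 * m%:R + 1)).
Proof.
case: m => // m _; elim: m => [|m IHm].
  by rewrite big_geq // subrr !(mulr0, mul0r).
rewrite big_nat_recr //= mulrDr IHm -[m.+2]addn1 natrD.
by move: m.+1%:R => x; ring.
Qed.

Lemma sum_cubic_form_sqr (R : comNzRingType) (c : R) (m : nat) : (0 < m)%N ->
  30 * (\sum_(1 <= a < m) (a%:R * (c - a%:R) * (a%:R + (c - a%:R))) ^+ 2) =
  (m%:R - 1) * c ^+ 2 * m%:R * (5 * c ^+ 2 * (2 * m%:R - 1)
    - 15 * c * m%:R * (m%:R - 1)
    + (2 * m%:R - 1) * (3 * m%:R ^+ 2 - 3 * m%:R - 1)).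
Proof.
case: m => // m _; elim: m => [|m IHm].
  by rewrite big_geq // subrr !(mulr0, mul0r).
rewrite big_nat_recr //= mulrDr IHm -[m.+2]addn1 natrD.
by move: m.+1%:R => x; ring.
Qed.

(** * The derivation q d/dq and congruences modulo a power of q *)

(* The derivation q d/dq. *)
Definition theta (R : nzRingType) (p : {poly R}) : {poly R} := 'X * p^`().

Lemma coef_theta (R : nzRingType) (p : {poly R}) i : (theta p)`_i = i%:R * p`_i.
Proof.
by rewrite /theta coefXM; case: i => [|i]; rewrite ?mul0r //= coef_deriv mulr_natl.
Qed.

Lemma thetaD (R : nzRingType) (p q : {poly R}) : theta (p + q) = theta p + theta q.
Proof. by rewrite /theta derivD mulrDr. Qed.

Lemma thetaN (R : nzRingType) (p : {poly R}) : theta (- p) = - theta p.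
Proof. by rewrite /theta derivN mulrN. Qed.

Lemma thetaM (R : comNzRingType) (p q : {poly R}) :
  theta (p * q) = theta p * q + p * theta q.
Proof. by rewrite /theta derivM; ring. Qed.

Lemma thetaMn (R : nzRingType) (k : nat) (p : {poly R}) :
  theta (k%:R * p) = k%:R * theta p.
Proof. by rewrite /theta !mulr_natl derivMn mulrnAr. Qed.

Lemma thetaXn (R : comNzRingType) (n : nat) : theta 'X^n = n%:R * 'X^n :> {poly R}.
Proof.
rewrite /theta derivXn; case: n => [|n]; first by rewrite mulr0n mulr0 mul0r.
by rewrite /= mulrnAr -exprS mulr_natl.
Qed.

Lemma thetaX (R : comNzRingType) (p : {poly R}) (n : nat) :
  theta (p ^+ n.+1) = n.+1%:R * p ^+ n * theta p.
Proof. by rewrite /theta deriv_exp /= -mulr_natl; ring. Qed.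

Lemma theta1 (R : nzRingType) : theta 1 = 0 :> {poly R}.
Proof. by rewrite /theta -polyC1 derivC mulr0. Qed.

(** Congruences modulo ['X^n] are stated with an explicit cofactor, so that [ring] can carry the
    error terms. *)
Lemma eq_modXn (R : comNzRingType) (n : nat) (p q : {poly R}) :
  (forall i, (i < n)%N -> p`_i = q`_i) -> exists u, p = q + 'X^n * u.
Proof.
move=> e; exists (drop_poly n (p - q)).
have -> : 'X^n * drop_poly n (p - q) = p - q.
  rewrite -[RHS](poly_take_drop n) mulrC [take_poly _ _](_ : _ = 0) ?add0r //.
  apply/polyP => i; rewrite coef_take_poly coef0.
  by case: ltnP => // /e pq; rewrite coefB pq subrr.
by rewrite addrC subrK.
Qed.

Lemma coef_modXn (R : comNzRingType) (n i : nat) (p q u : {poly R}) :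
  (i < n)%N -> p = q + 'X^n * u -> p`_i = q`_i.
Proof. by move=> lt_in ->; rewrite coefD coefXnM lt_in addr0. Qed.

Lemma coef_natM (R : nzRingType) (k : nat) (p : {poly R}) i :
  (k%:R * p)`_i = k%:R * p`_i.
Proof. by rewrite !mulr_natl coefMn. Qed.

(** * Skoruppa's identity for sums over representations *)

Section Convolution.

Variable R : realFieldType.

Lemma sum_reps_mul n (F G : nat -> R) :
  \sum_(t <- reps n) F t.1.1 * G t.2.1 =
  \sum_(1 <= m < n) (\sum_(d <- divisors m) F d) * \sum_(d <- divisors (n - m)) G d.
Proof.
rewrite big_allpairs_dep.
apply: eq_bigr => m _; rewrite big_allpairs /divisor_pairs.
rewrite big_map mulr_suml; apply: eq_bigr => d _.
by rewrite big_map mulr_sumr.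
Qed.

(** This rests on a x + b y = a (x + y) + (b - a) y; the bijection is run from the side a < b. *)
Lemma sum_reps_shear n (F : nat -> nat -> R) :
  \sum_(t <- reps n | (t.2.2 < t.1.2)%N) F t.1.1 t.2.1 =
  \sum_(t <- reps n | (t.1.1 < t.2.1)%N) F t.1.1 (t.2.1 - t.1.1)%N.
Proof.
rewrite -!(big_filter (reps n)); symmetry.
pose f (t : (nat * nat) * (nat * nat)) :=
  ((t.1.1, t.1.2 + t.2.2), (t.2.1 - t.1.1, t.2.2))%N.
pose g (t : (nat * nat) * (nat * nat)) :=
  ((t.1.1, t.1.2 - t.2.2), (t.2.1 + t.1.1, t.2.2))%N.
apply: (@sum_bij _ _ _ _ _ f g (fun t => F t.1.1 t.2.1)).
- by rewrite filter_uniq ?reps_uniq.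
- by rewrite filter_uniq ?reps_uniq.
- move=> [[a x] [b y]]; rewrite /f /g !mem_filter !mem_reps /= => h.
  by split; [nia | congr ((_, _), (_, _)); lia].
- move=> [[a x] [b y]]; rewrite /f /g !mem_filter !mem_reps /= => h.
  by split; [nia | congr ((_, _), (_, _)); lia].
Qed.

Lemma sum_reps_swap n (P : rel (nat * nat)) (F : nat -> nat -> R) :
  \sum_(t <- reps n | P t.2 t.1) F t.2.1 t.1.1 =
  \sum_(t <- reps n | P t.1 t.2) F t.1.1 t.2.1.
Proof.
rewrite -!(big_filter (reps n)).
pose f (t : (nat * nat) * (nat * nat)) := (t.2, t.1).
apply: (@sum_bij _ _ _ _ _ f f (fun t => F t.1.1 t.2.1)).
- by rewrite filter_uniq ?reps_uniq.
- by rewrite filter_uniq ?reps_uniq.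
- move=> [[a x] [b y]]; rewrite /f /= !mem_filter !mem_reps /= => h.
  by split => //; move: h; case: P => //=; lia.
- move=> [[a x] [b y]]; rewrite /f /= !mem_filter !mem_reps /= => h.
  by split => //; move: h; case: P => //=; lia.
Qed.

(** If x = y then n = (a + b) x, so d = a + b divides n and a ranges freely below d. *)
Lemma sum_reps_eq_xy n (F : nat -> nat -> R) : (0 < n)%N ->
  \sum_(t <- reps n | t.1.2 == t.2.2) F t.1.1 t.2.1 =
  \sum_(d <- divisors n) \sum_(1 <= a < d) F a (d - a)%N.
Proof.
move=> n0; pose s := [seq (p, a) | p <- divisor_pairs n, a <- index_iota 1 p.1].
transitivity (\sum_(u <- s) F u.2 (u.1.1 - u.2)%N); last first.
  by rewrite big_allpairs_dep /divisor_pairs big_map.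
rewrite -(big_filter (reps n)); symmetry.
pose f (u : (nat * nat) * nat) := ((u.2, u.1.2), (u.1.1 - u.2, u.1.2))%N.
pose g (t : (nat * nat) * (nat * nat)) := ((t.1.1 + t.2.1, t.1.2), t.1.1)%N.
have mem_s d x a : (((d, x), a) \in s) = [&& 0 < a, a < d, 0 < x & d * x == n]%N.
  apply/allpairsPdep/idP => [[[d' x'] [c [/= dm am [-> -> ->]]]]|h].
    by move: dm am; rewrite mem_divisor_pairs // mem_index_iota /=; lia.
  by exists (d, x), a; rewrite mem_divisor_pairs // mem_index_iota /=; split => //; lia.
apply: (@sum_bij _ _ _ _ _ f g (fun t => F t.1.1 t.2.1)).
- apply: allpairs_uniq_dep => [|p _|]; rewrite ?divisor_pairs_uniq ?iota_uniq //.
  by move=> [? ?] [? ?] _ _ /= [-> ->].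
- by rewrite filter_uniq ?reps_uniq.
- move=> [[d x] a]; rewrite /f /g !mem_filter !mem_reps mem_s /= => h.
  by split; [nia | congr ((_, _), _); lia].
- move=> [[a x] [b y]]; rewrite /f /g !mem_filter !mem_reps mem_s /= => h.
  by split; [nia | congr ((_, _), (_, _)); lia].
Qed.

(** If a = b = d then n = d (x + y), and n / d splits into two positive parts in n / d - 1 ways. *)
Lemma sum_reps_eq_ab n (F : nat -> R) : (0 < n)%N ->
  \sum_(t <- reps n | t.1.1 == t.2.1) F t.1.1 =
  \sum_(d <- divisors n) F d * (n%:R / d%:R - 1).
Proof.
move=> n0; pose s := [seq (p, x) | p <- divisor_pairs n, x <- index_iota 1 p.2].
transitivity (\sum_(u <- s) F u.1.1); last first.
  rewrite big_allpairs_dep /divisor_pairs big_map big_seq [RHS]big_seq.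
  apply: eq_bigr => d; rewrite -dvdn_divisors // => dn.
  have d0 := dvdn_gt0 n0 dn.
  rewrite /= sumr_const_nat -[LHS]mulr_natr natrB; last by rewrite divn_gt0 // dvdn_leq.
  by rewrite -[in RHS](divnK dn) natrM mulfK // pnatr_eq0 -lt0n.
rewrite -(big_filter (reps n)); symmetry.
pose f (u : (nat * nat) * nat) := ((u.1.1, u.2), (u.1.1, u.1.2 - u.2))%N.
pose g (t : (nat * nat) * (nat * nat)) := ((t.1.1, t.1.2 + t.2.2), t.1.2)%N.
have mem_s d e x : (((d, e), x) \in s) = [&& 0 < d, 0 < x, x < e & d * e == n]%N.
  apply/allpairsPdep/idP => [[[d' x'] [c [/= dm am [-> -> ->]]]]|h].
    by move: dm am; rewrite mem_divisor_pairs // mem_index_iota /=; lia.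
  by exists (d, e), x; rewrite mem_divisor_pairs // mem_index_iota /=; split => //; lia.
apply: (@sum_bij _ _ _ _ _ f g (fun t => F t.1.1)).
- apply: allpairs_uniq_dep => [|p _|]; rewrite ?divisor_pairs_uniq ?iota_uniq //.
  by move=> [? ?] [? ?] _ _ /= [-> ->].
- by rewrite filter_uniq ?reps_uniq.
- move=> [[d e] x]; rewrite /f /g !mem_filter !mem_reps mem_s /= => h.
  by split; [nia | congr ((_, _), _); lia].
- move=> [[a x] [b y]]; rewrite /f /g !mem_filter !mem_reps mem_s /= => h.
  by split; [nia | congr ((_, _), (_, _)); lia].
Qed.

(** Since H(a, b - a) = H(a, -b), the shear matches the part x > y of the first sum with the part a
    < b of the second. By symmetry the opposite parts agree as well, so only the diagonals x = y and
    a = b survive. *)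
Lemma sum_reps_invariant n (H : R -> R -> R) : (0 < n)%N ->
  (forall a b, H a b = H b a) -> (forall a b, H (- a) (- b) = H a b) ->
  (forall a b, H a (- a - b) = H a b) ->
  \sum_(t <- reps n) (H t.1.1%:R t.2.1%:R - H t.1.1%:R (- t.2.1%:R)) =
  \sum_(d <- divisors n) \sum_(1 <= a < d) H a%:R (d%:R - a%:R)
  - \sum_(d <- divisors n) H d%:R 0 * (n%:R / d%:R - 1).
Proof.
move=> n0 Hsym Hev Hrot.
pose K a b := H a (- b); pose h (a b : nat) := H a%:R b%:R.
have Ksym a b : K a b = K b a by rewrite /K -Hev opprK Hsym.
have shear (a b : nat) : (a < b)%N -> h a (b - a)%N = K a%:R b%:R.
  move=> ab; rewrite /h /K natrB 1?ltnW // -[RHS]Hrot opprK.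
  by congr H; rewrite addrC.
have split3 (P Q : (nat * nat) * (nat * nat) -> nat) (F : _ -> R) :
    \sum_(t <- reps n) F t = \sum_(t <- reps n | P t == Q t) F t
      + (\sum_(t <- reps n | (P t < Q t)%N) F t
         + \sum_(t <- reps n | (Q t < P t)%N) F t).
  rewrite (bigID (fun t => P t == Q t)) /=; congr +%R.
  rewrite (bigID (fun t => (P t < Q t)%N)) /=; congr +%R; apply: eq_bigl => t; lia.
have E1 : \sum_(t <- reps n | (t.2.2 < t.1.2)%N) h t.1.1 t.2.1 =
          \sum_(t <- reps n | (t.1.1 < t.2.1)%N) K t.1.1%:R t.2.1%:R.
  by rewrite sum_reps_shear; apply: eq_bigr => t /shear.
have E2 : \sum_(t <- reps n | (t.1.2 < t.2.2)%N) h t.1.1 t.2.1 =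
          \sum_(t <- reps n | (t.2.2 < t.1.2)%N) h t.1.1 t.2.1.
  rewrite -(sum_reps_swap n (fun p q => q.2 < p.2)%N h).
  by apply: eq_bigr => t _; apply: Hsym.
have E3 : \sum_(t <- reps n | (t.2.1 < t.1.1)%N) K t.1.1%:R t.2.1%:R =
          \sum_(t <- reps n | (t.1.1 < t.2.1)%N) K t.1.1%:R t.2.1%:R.
  rewrite -(sum_reps_swap n (fun p q => p.1 < q.1)%N (fun a b => K a%:R b%:R)).
  by apply: eq_bigr => t _; apply: Ksym.
rewrite big_split /= sumrN.
(* The first sum is cut by comparing x with y, the second by comparing a with b. *)
rewrite (split3 (fun t => t.1.2) (fun t => t.2.2)).
rewrite [in X in _ - X](split3 (fun t => t.1.1) (fun t => t.2.1)).
rewrite -/(K _ _) E3 (sum_reps_eq_xy h n0).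
rewrite E2 E1 -(sum_reps_eq_ab (fun d => H d%:R 0) n0).
(* On this diagonal H(a, -a) = H(a, 0) by the rotation. *)
have -> : \sum_(t <- reps n | t.1.1 == t.2.1) H t.1.1%:R (- t.2.1%:R) =
    \sum_(t <- reps n | t.1.1 == t.2.1) H t.1.1%:R 0.
  by apply: eq_bigr => t /eqP <-; rewrite -[RHS]Hrot subr0.
rewrite [RHS](_ : _ = \sum_(d <- divisors n) \sum_(1 <= a < d) h a (d - a)%N -
   \sum_(t <- reps n | t.1.1 == t.2.1) H t.1.1%:R 0); first by rewrite /K; lra.
congr (_ - _); apply: eq_bigr => d _; apply: eq_big_nat => a /andP[_ ad].
by rewrite /h natrB // ltnW.
Qed.

(** * Convolutions of divisor sums *)

Definition sigq (k n : nat) : R := (sigma k n)%:R.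

Lemma sigqE k n : sigq k n = \sum_(d <- divisors n) d%:R ^+ k.
Proof. by rewrite /sigq natr_sum; apply: eq_bigr => d _; rewrite natrX. Qed.

Lemma mul_sigq (c : R) k n : c * sigq k n = \sum_(d <- divisors n) c * d%:R ^+ k.
Proof. by rewrite sigqE mulr_sumr. Qed.

Lemma sum_sigq (c1 c3 c5 c7 : R) n :
  \sum_(d <- divisors n)
    (c1 * d%:R ^+ 1 + c3 * d%:R ^+ 3 + c5 * d%:R ^+ 5 + c7 * d%:R ^+ 7) =
  c1 * sigq 1 n + c3 * sigq 3 n + c5 * sigq 5 n + c7 * sigq 7 n.
Proof. by rewrite !mul_sigq !big_split. Qed.

Definition conv (k l n : nat) : R := \sum_(1 <= m < n) sigq k m * sigq l (n - m).

Lemma conv_reps k l n :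
  \sum_(t <- reps n) t.1.1%:R ^+ k * t.2.1%:R ^+ l = conv k l n.
Proof.
rewrite (sum_reps_mul n (fun d => d%:R ^+ k) (fun d => d%:R ^+ l)).
by apply: eq_bigr => m _; rewrite !sigqE.
Qed.

Lemma convC k l n : conv k l n = conv l k n.
Proof.
rewrite -!conv_reps.
rewrite -(sum_reps_swap n (fun _ _ => true) (fun a b => a%:R ^+ k * b%:R ^+ l)).
by apply: eq_bigr => t _; rewrite mulrC.
Qed.

(** The constant [c] clears denominators, and [C] is c H(d, 0) / d. The term c H(d, 0) left over
    from n / d - 1 supplies the two half endpoints a = 0 and a = d of the trapezoidal rule, which is
    why [p] is an odd polynomial in each application. *)
Lemma conv_invariant n (c : R) (H : R -> R -> R) (C p : R -> R) :
  (0 < n)%N ->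
  (forall a b, H a b = H b a) -> (forall a b, H (- a) (- b) = H a b) ->
  (forall a b, H a (- a - b) = H a b) ->
  (forall d, (0 < d)%N -> c * H d%:R 0 = d%:R * C d%:R) ->
  (forall d, (0 < d)%N ->
     c * (\sum_(1 <= a < d) H a%:R (d%:R - a%:R)) + c * H d%:R 0 = p d%:R) ->
  c * \sum_(t <- reps n) (H t.1.1%:R t.2.1%:R - H t.1.1%:R (- t.2.1%:R)) =
  \sum_(d <- divisors n) (p d%:R - n%:R * C d%:R).
Proof.
move=> n0 Hs He Hr HC Hp; rewrite sum_reps_invariant // -sumrB mulr_sumr.
rewrite big_seq [RHS]big_seq; apply: eq_bigr => d.
rewrite -dvdn_divisors // => /(dvdn_gt0 n0) d0; rewrite -Hp // -mulrDr.
have dN0 : d%:R != 0 :> R by rewrite pnatr_eq0 -lt0n.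
have -> : C d%:R = c * H d%:R 0 / d%:R by rewrite HC // mulrAC divff ?mul1r.
by field.
Qed.

Lemma conv11 n : (0 < n)%N ->
  12 * conv 1 1 n = 5 * sigq 3 n + sigq 1 n - 6 * n%:R * sigq 1 n.
Proof.
move=> n0.
have := @conv_invariant n 6 (fun a b => a ^+ 2 + a * b + b ^+ 2) (fun d => 6 * d)
  (fun d => 5 * d ^+ 3 + d) n0.
have -> : \sum_(t <- reps n) (
    (t.1.1%:R ^+ 2 + t.1.1%:R * t.2.1%:R + t.2.1%:R ^+ 2) -
    (t.1.1%:R ^+ 2 + t.1.1%:R * - t.2.1%:R + (- t.2.1%:R) ^+ 2)) =
   2 * conv 1 1 n.
  by rewrite -conv_reps mulr_sumr; apply: eq_bigr => t _; ring.
move=> h; transitivity (6 * (2 * conv 1 1 n)); first by ring.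
rewrite {}h => [|a b|a b|a b|d d0|d d0]; try by ring.
  etransitivity; last by etransitivity; [exact: (sum_sigq (1 - 6 * n%:R) 5 0 0 n) | ring].
  by apply: eq_bigr => d _; ring.
by rewrite (sum_quad_form d%:R d0) /=; move: d%:R => x; ring.
Qed.

(** This form vanishes at b = 0, so no term with a factor n appears. *)
Lemma conv33 n : (0 < n)%N -> 120 * conv 3 3 n = sigq 7 n - sigq 3 n.
Proof.
move=> n0.
have := @conv_invariant n 30 (fun a b => (a * b * (a + b)) ^+ 2) (fun=> 0)
  (fun d => d ^+ 7 - d ^+ 3) n0.
have -> : \sum_(t <- reps n) (
    (t.1.1%:R * t.2.1%:R * (t.1.1%:R + t.2.1%:R)) ^+ 2 -
    (t.1.1%:R * - t.2.1%:R * (t.1.1%:R + - t.2.1%:R)) ^+ 2) = 4 * conv 3 3 n.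
  by rewrite -conv_reps mulr_sumr; apply: eq_bigr => t _; ring.
move=> h; transitivity (30 * (4 * conv 3 3 n)); first by ring.
rewrite {}h => [|a b|a b|a b|d d0|d d0]; try by ring.
  etransitivity; last by etransitivity; [exact: (sum_sigq 0 (-1) 0 1 n) | ring].
  by apply: eq_bigr => d _; ring.
by rewrite (sum_cubic_form_sqr d%:R d0) /=; move: d%:R => x; ring.
Qed.

Lemma conv13 n : (0 < n)%N ->
  240 * conv 1 3 n =
  21 * sigq 5 n + 10 * sigq 3 n - sigq 1 n - 30 * n%:R * sigq 3 n.
Proof.
move=> n0.
have := @conv_invariant n 30 (fun a b => (a ^+ 2 + a * b + b ^+ 2) ^+ 2)
  (fun d => 30 * d ^+ 3) (fun d => 21 * d ^+ 5 + 10 * d ^+ 3 - d) n0.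
have -> : \sum_(t <- reps n) (
    (t.1.1%:R ^+ 2 + t.1.1%:R * t.2.1%:R + t.2.1%:R ^+ 2) ^+ 2 -
    (t.1.1%:R ^+ 2 + t.1.1%:R * - t.2.1%:R + (- t.2.1%:R) ^+ 2) ^+ 2) =
   4 * conv 1 3 n + 4 * conv 3 1 n.
  rewrite -!conv_reps !mulr_sumr -big_split.
  by apply: eq_bigr => t _ /=; ring.
rewrite (convC 3 1) => h.
transitivity (30 * (4 * conv 1 3 n + 4 * conv 1 3 n)); first by ring.
rewrite {}h => [|a b|a b|a b|d d0|d d0]; try by ring.
  etransitivity; last by etransitivity;
    [exact: (sum_sigq (-1) (10 - 30 * n%:R) 21 0 n) | ring].
  by apply: eq_bigr => d _; ring.
by rewrite (sum_quad_form2 d%:R d0) /=; move: d%:R => x; ring.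
Qed.

Lemma conv15 n : (0 < n)%N ->
  504 * conv 1 5 n =
  20 * sigq 7 n + 21 * sigq 5 n + sigq 1 n - 42 * n%:R * sigq 5 n.
Proof.
move=> n0; have c33 := conv33 n0.
have := @conv_invariant n 420 (fun a b => (a ^+ 2 + a * b + b ^+ 2) ^+ 3)
  (fun d => 420 * d ^+ 5)
  (fun d => 249 * d ^+ 7 + 210 * d ^+ 5 - 49 * d ^+ 3 + 10 * d) n0.
(* With s = a^2 + b^2 and p = a b, (s + p)^3 - (s - p)^3 = 6 s^2 p + 2 p^3; the resulting a^3 b^3
   terms are removed by [conv33]. *)
have -> : \sum_(t <- reps n) (
    (t.1.1%:R ^+ 2 + t.1.1%:R * t.2.1%:R + t.2.1%:R ^+ 2) ^+ 3 -
    (t.1.1%:R ^+ 2 + t.1.1%:R * - t.2.1%:R + (- t.2.1%:R) ^+ 2) ^+ 3) =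
   6 * conv 1 5 n + 6 * conv 5 1 n + 14 * conv 3 3 n.
  rewrite -!conv_reps !mulr_sumr -!big_split.
  by apply: eq_bigr => t _ /=; ring.
rewrite (convC 5 1) => h.
suff: 420 * (6 * conv 1 5 n + 6 * conv 1 5 n + 14 * conv 3 3 n) =
    249 * sigq 7 n + 210 * sigq 5 n - 49 * sigq 3 n + 10 * sigq 1 n
    - 420 * n%:R * sigq 5 n by move=> e; lra.
rewrite {}h => [|a b|a b|a b|d d0|d d0]; try by ring.
  etransitivity; last by etransitivity;
    [exact: (sum_sigq 10 (-49) (210 - 420 * n%:R) 249 n) | ring].
  by apply: eq_bigr => d _; ring.
by rewrite (sum_quad_form3 d%:R d0) /=; move: d%:R => x; ring.
Qed.

(** * Ramanujan's differential equations and the discriminant *)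

(* sigma k 0 = 1, because divisors 0 = [:: 1], whence the explicit 0 < i. *)
Definition sig_poly (N k : nat) : {poly R} :=
  \poly_(i < N.+1) (sigq k i *+ (0 < i)%N).

Lemma coef_sig N k i : (i <= N)%N -> (sig_poly N k)`_i = sigq k i *+ (0 < i)%N.
Proof. by move=> iN; rewrite coef_poly ltnS iN. Qed.

Lemma coef_sig0 N k : (sig_poly N k)`_0 = 0.
Proof. by rewrite coef_sig. Qed.

Lemma coef_sigS N k i : (i < N)%N -> (sig_poly N k)`_i.+1 = sigq k i.+1.
Proof. by move=> iN; rewrite coef_sig. Qed.

Lemma coef_sigM N k l i : (i <= N)%N ->
  (sig_poly N k * sig_poly N l)`_i = conv k l i.
Proof.
move=> iN; rewrite coefM.
rewrite -(big_mkord predT (fun j => (sig_poly N k)`_j * (sig_poly N l)`_(i - j))).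
case: i iN => [|i] iN.
  by rewrite big_nat1 coef_sig // mul0r /conv big_geq.
(* The summands j = i and j = 0 vanish with the constant coefficients, leaving the range of
   [conv]. *)
rewrite big_nat_recr //= subnn [X in _ * X]coef_sig // mulr0 addr0.
rewrite big_ltn // coef_sig // mul0r add0r /conv.
apply: eq_big_nat => j /andP[j0 ji].
rewrite !coef_sig ?j0 ?subn_gt0 ?ji //; last by rewrite (leq_trans _ iN) // ltnW.
by rewrite (leq_trans _ iN) // leq_subr.
Qed.

(* Ramanujan's P, Q, R (the Eisenstein series E_2, E_4, E_6), truncated after
   degree N: all identities between them hold modulo 'X^(N.+1). *)
Definition eisP N : {poly R} := 1 - 24 * sig_poly N 1.
Definition eisQ N : {poly R} := 1 + 240 * sig_poly N 3.
Definition eisR N : {poly R} := 1 - 504 * sig_poly N 5.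

(** Coefficientwise this is [conv11]; the next two equations come from [conv13], and from [conv15]
    with [conv33]. *)
Lemma theta_eisP N : exists u,
  12 * theta (eisP N) = eisP N ^+ 2 - eisQ N + 'X^(N.+1) * u.
Proof.
apply: eq_modXn => i; rewrite ltnS => iN.
have -> : eisP N ^+ 2 - eisQ N = 576 * (sig_poly N 1 * sig_poly N 1)
    - 48 * sig_poly N 1 - 240 * sig_poly N 3 by rewrite /eisP /eisQ; ring.
rewrite /eisP thetaD thetaN theta1 add0r thetaMn.
rewrite !(coefB, coefN, coef_natM) coef_theta.
case: i iN => [_|i iN].
  by rewrite !coef0M !coef_sig0 !(mulr0, oppr0, addr0).
rewrite !coef_sigM // !coef_sigS //.
have := @conv11 i.+1 isT; lra.
Qed.

Lemma theta_eisQ N : exists u,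
  3 * theta (eisQ N) = eisP N * eisQ N - eisR N + 'X^(N.+1) * u.
Proof.
apply: eq_modXn => i; rewrite ltnS => iN.
have -> : eisP N * eisQ N - eisR N = 240 * sig_poly N 3 + 504 * sig_poly N 5
    - 24 * sig_poly N 1 - 24 * (240 * (sig_poly N 1 * sig_poly N 3)).
  by rewrite /eisP /eisQ /eisR; ring.
rewrite /eisQ thetaD theta1 add0r thetaMn.
rewrite !(coefB, coefD, coef_natM) coef_theta.
case: i iN => [_|i iN].
  by rewrite !coef0M !coef_sig0 !(mulr0, oppr0, addr0).
rewrite !coef_sigM // !coef_sigS //.
have := @conv13 i.+1 isT; lra.
Qed.

Lemma theta_eisR N : exists u,
  2 * theta (eisR N) = eisP N * eisR N - eisQ N ^+ 2 + 'X^(N.+1) * u.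
Proof.
apply: eq_modXn => i; rewrite ltnS => iN.
have -> : eisP N * eisR N - eisQ N ^+ 2 = 24 * (504 * (sig_poly N 1 * sig_poly N 5))
    - 24 * sig_poly N 1 - 504 * sig_poly N 5 - 480 * sig_poly N 3
    - 240 * (240 * (sig_poly N 3 * sig_poly N 3)).
  by rewrite /eisP /eisQ /eisR; ring.
rewrite /eisR thetaD thetaN theta1 add0r thetaMn.
rewrite !(coefB, coefN, coef_natM) coef_theta.
case: i iN => [_|i iN].
  by rewrite !coef0M !coef_sig0 !(mulr0, oppr0, addr0).
rewrite !coef_sigM // !coef_sigS //.
have := @conv15 i.+1 isT; have := @conv33 i.+1 isT; lra.
Qed.

(** Unlike the plain derivative, [theta] loses no precision: it maps ['X^(N.+1)] to a multiple of
    itself. *)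
Lemma theta_modX N (p q u : {poly R}) : p = q + 'X^(N.+1) * u ->
  exists v, theta p = theta q + 'X^(N.+1) * v.
Proof.
move=> ->; exists (N.+1%:R * u + theta u).
by rewrite thetaD thetaM thetaXn; ring.
Qed.

(** In Q^2 (P Q - R) - R (P R - Q^2) the mixed terms Q^2 R cancel. *)
Lemma theta_discriminant N : exists u,
  theta (eisQ N ^+ 3 - eisR N ^+ 2) =
  eisP N * (eisQ N ^+ 3 - eisR N ^+ 2) + 'X^(N.+1) * u.
Proof.
have [u eQ] := theta_eisQ N; have [v eR] := theta_eisR N.
exists (eisQ N ^+ 2 * u - eisR N * v).
rewrite thetaD thetaN !thetaX expr1.
transitivity (eisQ N ^+ 2 * (3 * theta (eisQ N)) - eisR N * (2 * theta (eisR N))).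
  by ring.
by rewrite eQ eR; ring.
Qed.

(** The left side is a multiple of the second Rankin-Cohen bracket of E_4 with itself, a cusp form
    of weight 12. Eliminating all derivatives by Ramanujan's equations makes P cancel. *)
Lemma discriminant_theta2 N : exists u,
  36 * (4 * eisQ N * theta (theta (eisQ N)) - 5 * theta (eisQ N) ^+ 2) =
  20 * (eisQ N ^+ 3 - eisR N ^+ 2) + 'X^(N.+1) * u.
Proof.
have [w eP] := theta_eisP N.
have [u eQ] := theta_eisQ N; have [v eR] := theta_eisR N.
have [x eQ2] : exists x, 3 * theta (theta (eisQ N)) =
    theta (eisP N) * eisQ N + eisP N * theta (eisQ N) - theta (eisR N)
    + 'X^(N.+1) * x.
  have [x] := theta_modX eQ; rewrite thetaMn (thetaD (eisP N * eisQ N)).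
  by rewrite (thetaN (eisR N)) (thetaM (eisP N)) => ->; exists x.
set P := eisP N in eP eQ eR eQ2 *; set Q := eisQ N in eP eQ eR eQ2 *.
(* [T] is Ramanujan's R, as the letter [R] denotes the base field. *)
set T := eisR N in eP eQ eR eQ2 *; set X := 'X^_ in eP eQ eR eQ2 *.
(* The witness collects the errors of the substitutions below; its last group comes from squaring 3
   D Q = P Q - T + X u. *)
exists (4 * Q ^+ 2 * w + 16 * Q * P * u - 24 * Q * v + 48 * Q * x
  - 20 * (2 * (P * Q - T) * u + X * u ^+ 2)).
transitivity (48 * Q * (3 * theta (theta Q)) - 20 * (3 * theta Q) ^+ 2).
  by ring.
rewrite eQ2.
transitivity (4 * Q ^+ 2 * (12 * theta P) + 16 * Q * P * (3 * theta Q)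
  - 24 * Q * (2 * theta T) + 48 * Q * X * x - 20 * (3 * theta Q) ^+ 2).
  by ring.
by rewrite eP eQ eR; ring.
Qed.

Lemma theta_P_unique N (f u : {poly R}) :
  theta f = eisP N * f + 'X^(N.+1) * u -> f`_0 = 0 -> f`_1 = 0 ->
  forall i, (i <= N)%N -> f`_i = 0.
Proof.
move=> ef f0 f1; elim/ltn_ind => i IH iN.
case: i => [|[|i]] // in IH iN *.
have := congr1 (fun p : {poly R} => p`_i.+2) ef.
rewrite coefD coefXnM ltnS iN addr0 coef_theta coefM big_ord_recl big1 => [|j _].
  rewrite addr0 subn0 /eisP coefB coef1 coef_natM coef_sig0 mulr0 subr0 mul1r.
  rewrite -natr1 mulrDl mul1r => /(canRL (addrK _)); rewrite subrr.
  by move/eqP; rewrite mulf_eq0 pnatr_eq0 /= => /eqP.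
by rewrite IH ?mulr0 //= /bump; lia.
Qed.

(** * Logarithmic derivative of the product defining tau *)

(** Truncation of the geometric series q^k / (1 - q^k). *)
Definition geomX (N k : nat) : {poly R} := \sum_(1 <= j < N.+1) 'X^(k * j).

Lemma geomXE N k : (1 - 'X^k) * geomX N k = 'X^k - 'X^(k * N.+1).
Proof.
rewrite /geomX; elim: N => [|N IHN]; first by rewrite big_geq // muln1 subrr mulr0.
by rewrite big_nat_recr //= mulrDr IHN [(k * N.+2)%N]mulnS exprD; ring.
Qed.

Lemma theta_factor N k : (0 < k)%N -> exists u,
  theta ((1 - 'X^k) ^+ 24) =
  (1 - 'X^k) ^+ 24 * (- 24 * (k%:R * geomX N k)) + 'X^(N.+1) * u :> {poly R}.
Proof.
(* The truncation error q^(k (N + 1)) factors as q^(N + 1) q^((k - 1) (N + 1)) because k > 0. *)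
move=> k0; exists (- 24 * k%:R * (1 - 'X^k) ^+ 23 * 'X^(k.-1 * N.+1)).
rewrite thetaX thetaD thetaN theta1 thetaXn add0r.
have : 'X^k = (1 - 'X^k) * geomX N k + 'X^(N.+1) * 'X^(k.-1 * N.+1) :> {poly R}.
  by rewrite geomXE -exprD -mulSn prednK // subrK.
move: (1 - 'X^k) => E eX.
transitivity (- 24 * k%:R * E ^+ 23 * 'X^k); first by ring.
by rewrite eX; ring.
Qed.

Definition delta_poly (K : nat) : {poly R} := 'X * \prod_(1 <= k < K.+1) (1 - 'X^k) ^+ 24.

(** The number [K] of factors is separate from the precision [N], so that the induction on [K] keeps
    one modulus. *)
Lemma theta_delta_poly_trunc N K : exists u,
  theta (delta_poly K) =
  delta_poly K * (1 - 24 * \sum_(1 <= k < K.+1) k%:R * geomX N k) + 'X^(N.+1) * u.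
Proof.
elim: K => [|K [u IHK]].
  exists 0; rewrite /delta_poly !big_geq // !mulr1 mulr0 subr0 mulr1 mulr0 addr0.
  by rewrite -[X in theta X]expr1 thetaXn mul1r expr1.
have [v ev] := @theta_factor N K.+1 isT.
exists (u * (1 - 'X^(K.+1)) ^+ 24 + delta_poly K * v).
have -> : delta_poly K.+1 = delta_poly K * (1 - 'X^(K.+1)) ^+ 24.
  by rewrite /delta_poly big_nat_recr //= mulrA.
rewrite thetaM ev IHK (@big_nat_recr _ _ _ K.+1) //=.
move: (_ ^+ 24) (delta_poly K) => E d; ring.
Qed.

(** The Lambert series of sigma_1: for i > 0, q^i occurs in the k-th geometric series exactly when k
    divides i. *)
Lemma coef_sum_geomX N i : (i <= N)%N ->
  (\sum_(1 <= k < N.+1) k%:R * geomX N k)`_i = (sig_poly N 1)`_i.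
Proof.
move=> iN; rewrite coef_sig // coef_sum.
(* The guard [0 < i] is needed since every k divides 0 while the series have no constant term. *)
transitivity (\sum_(1 <= k < N.+1 | (0 < i)%N && (k %| i)%N) (k%:R : R)).
  rewrite [RHS]big_mkcond; apply: eq_big_nat => k /andP[k0 _].
  rewrite coef_natM coef_sum; case: ifP => [/andP[i0 /dvdnP[q iE]]|ki].
    have q0 : (0 < q)%N by move: i0; rewrite iE muln_gt0 => /andP[].
    rewrite (bigD1_seq q) ?iota_uniq //=; last first.
      by rewrite mem_index_iota q0 ltnS (leq_trans _ iN) // iE leq_pmulr.
    rewrite coefXn iE mulnC eqxx big1 ?addr0 ?mulr1 // => j jq.
    by rewrite coefXn; case: eqP => // e; case/eqP: jq; nia.
  rewrite big_nat big1 ?mulr0 // => j /andP[j0 _]; rewrite coefXn.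
  case: eqP => // iE; move: ki; rewrite iE muln_gt0 k0 j0 /=.
  by rewrite dvdn_mulr.
case: posnP => [->|i0]; first by rewrite big_pred0.
rewrite mulr1n sigqE -big_filter; apply: perm_big.
apply: uniq_perm; rewrite ?filter_uniq ?iota_uniq ?divisors_uniq // => d.
rewrite mem_filter mem_index_iota -dvdn_divisors // andb_idr // => di.
by rewrite (dvdn_gt0 i0 di) ltnS (leq_trans (dvdn_leq i0 di)).
Qed.

Lemma theta_delta_poly N : exists u,
  theta (delta_poly N) = eisP N * delta_poly N + 'X^(N.+1) * u.
Proof.
have [u ->] := theta_delta_poly_trunc N N.
have [v ->] : exists v, \sum_(1 <= k < N.+1) k%:R * geomX N k =
    sig_poly N 1 + 'X^(N.+1) * v.
  by apply: eq_modXn => i iN; rewrite coef_sum_geomX.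
exists (u - 24 * delta_poly N * v); rewrite /eisP; ring.
Qed.

Lemma coef_delta_poly N i : (i <= N)%N -> (delta_poly N)`_i = (tau i)%:~R.
Proof.
move=> iN; have -> : delta_poly N = map_poly intr (delta_partial N).
  rewrite /delta_partial /delta_poly rmorphM /= map_polyX rmorph_prod.
  rewrite [X in _ = _ * X](eq_bigr (fun k => (1 - 'X^k) ^+ 24)) // => k _.
  by rewrite rmorphXn rmorphB rmorph1 /= map_polyXn.
by rewrite coef_map (delta_partial_coef iN).
Qed.

(** * Comparison with tau and the first identity *)

Lemma tau1 : tau 1 = 1.
Proof.
rewrite /tau /delta_partial big_nat1 coefXM /= -horner_coef0.
by rewrite !hornerE expr1n.
Qed.

Lemma sigq1 k : sigq k 1 = 1.
Proof. by rewrite sigqE big_seq1 expr1n. Qed.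

(** Both sides solve D f = P f modulo q^(N + 1), so [theta_P_unique] reduces the claim to the
    coefficients 0 and 1. *)
Lemma discriminant_eq N i : (i <= N)%N ->
  (eisQ N ^+ 3 - eisR N ^+ 2)`_i = 1728 * (tau i)%:~R.
Proof.
move=> iN; pose f := eisQ N ^+ 3 - eisR N ^+ 2 - 1728 * delta_poly N.
have fE j : f`_j = (eisQ N ^+ 3 - eisR N ^+ 2)`_j - 1728 * (delta_poly N)`_j.
  by rewrite coefB coef_natM.
suff: f`_i = 0 by rewrite fE coef_delta_poly // => /subr0_eq.
have [u eu] := theta_discriminant N; have [v ev] := theta_delta_poly N.
have ef : theta f = eisP N * f + 'X^(N.+1) * (u - 1728 * v).
  by rewrite /f thetaD thetaN thetaMn eu ev; ring.
have fS : f = 720 * sig_poly N 3 + 1008 * sig_poly N 5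
    + 240 * (720 * (sig_poly N 3 * sig_poly N 3))
    + 240 * (240 * (240 * (sig_poly N 3 * (sig_poly N 3 * sig_poly N 3))))
    - 504 * (504 * (sig_poly N 5 * sig_poly N 5)) - 1728 * delta_poly N.
  by rewrite /f /eisQ /eisR; ring.
have f0 : f`_0 = 0.
  rewrite fS !(coefB, coefD, coef_natM) /delta_poly coefXM /= !coef0M !coef_sig0.
  by rewrite !(mulr0, addr0, oppr0).
(* For N = 0 the coefficient at 1 lies beyond the precision, but only i = 0 is asked for. *)
case: (posnP N) => [N0|N0]; first by move: iN; rewrite N0 leqn0 => /eqP ->.
apply: theta_P_unique ef f0 _ _ iN.
(* The products start at q^2, so the coefficient at 1 is 720 + 1008 - 1728 = 0. *)
rewrite fS !(coefB, coefD, coef_natM) coef_delta_poly // tau1.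
rewrite !coefM !big_ord_recl !big_ord0 /= !coef_sig0 !coef_sigS // !sigq1.
by rewrite /bump leqnn subnn coef0M coef_sig0 !(mul0r, mulr0, addr0); ring.
Qed.

Lemma tau_identity n : (0 < n)%N ->
  (tau n)%:~R = n%:R ^+ 2 * sigq 7 n - 540 * \sum_(1 <= m < n)
    m%:R * (n - m)%N%:R * sigq 3 m * sigq 3 (n - m).
Proof.
move=> n0; have [u eu] := discriminant_theta2 n.
have := coef_modXn (ltnSn n) eu.
(* Trading Q D^2 Q for D^2 (Q^2) leaves (D Q)^2 as the only convolution once Q^2 = E_8 is used. *)
have -> : 36 * (4 * eisQ n * theta (theta (eisQ n)) - 5 * theta (eisQ n) ^+ 2) =
  72 * theta (theta (eisQ n ^+ 2)) - 324 * (theta (eisQ n) * theta (eisQ n)).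
  by rewrite thetaX expr1 !thetaM -[2%:R]mulr1 thetaMn theta1; ring.
have -> : eisQ n ^+ 2 =
    1 + (480 * sig_poly n 3 + 240 * (240 * (sig_poly n 3 * sig_poly n 3))).
  by rewrite /eisQ; ring.
have -> : theta (eisQ n) = 240 * theta (sig_poly n 3).
  by rewrite thetaD theta1 add0r thetaMn.
rewrite thetaD theta1 add0r coefB !coef_natM !coef_theta.
have -> : 240 * theta (sig_poly n 3) * (240 * theta (sig_poly n 3)) =
  240 * (240 * (theta (sig_poly n 3) * theta (sig_poly n 3))) by ring.
rewrite coefD !coef_natM discriminant_eq // coef_sigM //.
rewrite coef_sig // n0 mulr1n.
set S := \sum_(1 <= m < n) _.
have -> : (theta (sig_poly n 3) * theta (sig_poly n 3))`_n = S.
  rewrite coefM -(big_mkord predT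
    (fun j => (theta (sig_poly n 3))`_j * (theta (sig_poly n 3))`_(n - j))).
  rewrite big_nat_recr //= subnn coef_theta [X in _ + _ * X]coef_theta.
  rewrite mul0r mulr0 addr0 big_ltn // coef_theta mul0r mul0r add0r.
  apply: eq_big_nat => j /andP[j0 jn]; rewrite !coef_theta.
  rewrite !coef_sig ?leq_subr ?(ltnW jn) // subn_gt0 jn j0 !mulr1n; ring.
have := conv33 n0.
move: (conv _ _ _) (sigq 3 n) (sigq 7 n) => c s3 s7 ec eq.
(* This turns the n-th coefficient of Q^2 into 480 sigma_7(n); dividing by 20 * 1728 = 72 * 480 then
   produces the factor 540. *)
have e7 : 240 * (240 * c) = 480 * (s7 - s3) by rewrite -ec; ring.
by move: eq; rewrite e7; lra.
Qed.

End Convolution.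

(** * Symmetrization and the four identities *)

Lemma sum_symmetrize (R : comNzRingType) n (F : nat -> nat -> R) :
  2 * \sum_(1 <= m < n) F m (n - m)%N =
  \sum_(1 <= m < n) (F m (n - m)%N + F (n - m)%N m).
Proof.
rewrite big_split /= mulr_natl mulr2n; congr (_ + _).
rewrite big_nat_rev /= !big_nat; apply: eq_bigr => m /andP[m0 mn].
by rewrite add1n subSS subKn // ltnW.
Qed.

Theorem theorem2p1 (n : nat) (n_ge1 : (1 <= n)%N) :
  [/\ (tau n)%:~R = n%:R ^+ 2 * (sigma 7 n)%:R
        - 540 * \sum_(1 <= m < n)
            m%:R * (n - m)%N%:R * (sigma 3 m)%:R * (sigma 3 (n - m))%:R :> rat,
      (tau n)%:~R = - (5 / 4) * n%:R ^+ 2 * (sigma 7 n)%:R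
        + 9 / 4 * n%:R ^+ 2 * (sigma 3 n)%:R
        + 540 * \sum_(1 <= m < n)
            m%:R ^+ 2 * (sigma 3 m)%:R * (sigma 3 (n - m))%:R :> rat,
      (tau n)%:~R = n%:R ^+ 2 * (sigma 7 n)%:R
        - 1080 / n%:R * \sum_(1 <= m < n)
            m%:R ^+ 2 * (n - m)%N%:R * (sigma 3 m)%:R * (sigma 3 (n - m))%:R
        :> rat
    & (tau n)%:~R = - (1 / 2) * n%:R ^+ 2 * (sigma 7 n)%:R
        + 3 / 2 * n%:R ^+ 2 * (sigma 3 n)%:R
        + 360 / n%:R * \sum_(1 <= m < n)
            m%:R ^+ 3 * (sigma 3 m)%:R * (sigma 3 (n - m))%:R :> rat].
Proof.
have n_neq0 : n%:R != 0 :> rat by rewrite pnatr_eq0 -lt0n.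
have := @conv33 rat n n_ge1; have := @tau_identity rat n n_ge1.
rewrite /conv /sigq; set S := \sum_(1 <= m < n) _ => tauE convE.
set T := \sum_(1 <= m < n) _ in convE.
have sub_nat m : (m < n)%N -> (n - m)%N%:R = n%:R - m%:R :> rat.
  by move=> /ltnW; apply: natrB.
set S2 := \sum_(1 <= m < n) _ * _ * _.
(* With a + b = n, a^2 + b^2 = n^2 - 2 a b. *)
have S2E : 2 * S2 = n%:R ^+ 2 * T - 2 * S.
  rewrite (sum_symmetrize n (fun a b => a%:R ^+ 2 * (sigma 3 a)%:R * (sigma 3 b)%:R)).
  rewrite !mulr_sumr -sumrB; apply: eq_big_nat => m /andP[_ /sub_nat->]; ring.
set S3 := \sum_(1 <= m < n) _ ^+ 2 * _ * _ * _.
(* Here a^2 b + a b^2 = n a b. *)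
have S3E : 2 * S3 = n%:R * S.
  rewrite (sum_symmetrize n
    (fun a b => a%:R ^+ 2 * b%:R * (sigma 3 a)%:R * (sigma 3 b)%:R)).
  rewrite mulr_sumr; apply: eq_big_nat => m /andP[_ /sub_nat->]; ring.
set S4 := \sum_(1 <= m < n) _ ^+ 3 * _ * _.
(* Here a^3 + b^3 = n^3 - 3 n a b. *)
have S4E : 2 * S4 = n%:R ^+ 3 * T - 3 * n%:R * S.
  rewrite (sum_symmetrize n (fun a b => a%:R ^+ 3 * (sigma 3 a)%:R * (sigma 3 b)%:R)).
  rewrite !mulr_sumr -sumrB; apply: eq_big_nat => m /andP[_ /sub_nat->]; ring.
clearbody S T S2 S3 S4.
move: (n%:R) (sigma 7 n)%:R (sigma 3 n)%:R (tau n)%:~R n_neq0 tauE convE S2E S3E S4E.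
move=> x s7 s3 t x0 tauE convE S2E S3E S4E.
(* Once sigma_7 is eliminated, all four claims are rational identities in n, [S], [T] and
   sigma_3(n). *)
have s7E : s7 = 120 * T + s3 by rewrite convE subrK.
have {S2E} -> : S2 = (x ^+ 2 * T - 2 * S) / 2 by rewrite -S2E mulrC mulKf.
have {S3E} -> : S3 = x * S / 2 by rewrite -S3E mulrC mulKf.
have {S4E} -> : S4 = (x ^+ 3 * T - 3 * x * S) / 2 by rewrite -S4E mulrC mulKf.
by rewrite tauE s7E; split; field.
Qed.
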